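(* Let $G,H$ be groups, and let $\phi:G\to\mathrm{Aut}(H)$ be an action of $G$ on $H$. Let $\widehat{H}$ be the subgroup of $H$ generated by the elements of the form $\phi(g)(h)\cdot h^{-1}$, where $g\in G$, $h\in H$, and let $L$ be the subgroup of $H$ generated by $\Gamma_2(H)$ and $\widehat{H}$. Then $\phi$ induces an action (also denoted by $\phi$) of $\Gamma_2(G)$ on $L$, and $$L\rtimes_\phi\Gamma_2(G)=\Gamma_2(H\rtimes_\phi G).$$ In particular, $\Gamma_2(H\rtimes_\phi G)$ is the subgroup generated by $\Gamma_2(H)$, $\Gamma_2(G)$ and $\widehat{H}$.
   Context: $\Gamma_2(K)=[K,K]$ denotes the commutator subgroup of a group $K$. The group operation of $H\rtimes_\phi G$ is $(h,g)(h',g')=(h\,\phi(g)(h'),gg')$, and subgroups of $H$ and of $G$ are identified with the corresponding subgroups of $H\rtimes_\phi G$ via $h\mapsto(h,1)$ and $g\mapsto(1,g)$. *)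

(* Defs.v *)
(* Groups are [groupType]s (not necessarily finite).  Subsets
   are the Prop-valued sets of mathcomp-classical, whose axioms also provide
   the [choiceType] structure that [groupType] demands of Aut(H). *)
From HB Require Import structures.
From mathcomp Require Import all_boot.
From mathcomp Require Import boolp classical_sets.

Set Implicit Arguments.
Unset Strict Implicit.
Unset Printing Implicit Defensive.

Local Open Scope classical_set_scope.
Local Open Scope group_scope.

Record subgroup (G : groupType) := Subgroup {
  sg_set :> set G;
  sg_closed : group_closed (mem sg_set)
}.

(* A subgroup, seen as a group in its own right. *)
Definition sg_group (G : groupType) (K : subgroup G) : Type :=
  {x : G | mem (sg_set K) x}.

HB.instance Definition _ (G : groupType) (K : subgroup G) :=
  SubChoice.on (sg_group K).
HB.instance Definition _ (G : groupType) (K : subgroup G) :=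
  SubChoice_isSubGroup.Build G (mem (sg_set K)) (sg_group K) (sg_closed K).

Section Generated.
Variable G : groupType.

Definition gen_set (S : set G) : set G :=
  smallest (fun A : set G => group_closed (mem A)) S.

Lemma gen_set_closed (S : set G) : group_closed (mem (gen_set S)).
Proof.
split; first by apply/mem_set => A [[A1 _] _]; exact/set_mem.
move=> x y /set_mem Sx /set_mem Sy; apply/mem_set => A AS.
have [[_ AV] _] := AS.
by apply/set_mem/AV; apply/mem_set; [exact: Sx | exact: Sy].
Qed.

Definition gen (S : set G) : subgroup G := Subgroup (gen_set_closed S).

Definition Gamma2 : subgroup G := gen [set z | exists x y : G, z = [~ x, y]].

End Generated.

Section Automorphisms.
Variable H : groupType.

(* The inverse map is part of the data; it is determined by [aut_fun], so two
   automorphisms are equal iff their underlying functions are. *)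
Record aut := Aut {
  aut_fun :> H -> H;
  aut_inv : H -> H;
  aut_morph : {morph aut_fun : x y / x * y};
  aut_funK : cancel aut_fun aut_inv;
  aut_invK : cancel aut_inv aut_fun
}.

Lemma aut_eq (f g : aut) : f =1 g -> f = g.
Proof.
case: f g => [f f' fM fK f'K] [g g' gM gK g'K] /= /funext fg.
case: _ / fg in gM gK g'K *.
have e : f' = g' by apply/funext => x; rewrite -{1}(g'K x) fK.
case: _ / e in gK g'K *.
by congr Aut; exact: Prop_irrelevance.
Qed.

HB.instance Definition _ := gen_eqMixin aut.
HB.instance Definition _ := gen_choiceMixin aut.

Definition aut_one : aut :=
  @Aut idfun idfun (fun _ _ => erefl) (fun _ => erefl) (fun _ => erefl).

Lemma aut_mul_morph (f g : aut) : {morph f \o g : x y / x * y}.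
Proof. by move=> x y /=; rewrite !aut_morph. Qed.

Definition aut_mul (f g : aut) : aut :=
  Aut (@aut_mul_morph f g)
    (can_comp (@aut_funK f) (@aut_funK g))
    (can_comp (@aut_invK g) (@aut_invK f)).

Lemma aut_inv_morph (f : aut) : {morph aut_inv f : x y / x * y}.
Proof.
by move=> x y; rewrite -{1}(aut_invK f x) -{1}(aut_invK f y) -aut_morph aut_funK.
Qed.

Definition aut_invg (f : aut) : aut :=
  Aut (@aut_inv_morph f) (@aut_invK f) (@aut_funK f).

Fact aut_mulA : associative aut_mul.
Proof. by move=> f g h; exact: aut_eq. Qed.
Fact aut_mul1 : left_id aut_one aut_mul.
Proof. by move=> f; exact: aut_eq. Qed.
Fact aut_mul1r : right_id aut_one aut_mul.
Proof. by move=> f; exact: aut_eq. Qed.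
Fact aut_mulV : left_inverse aut_one aut_invg aut_mul.
Proof. by move=> f; apply: aut_eq => x /=; exact: aut_funK. Qed.
Fact aut_mulVr : right_inverse aut_one aut_invg aut_mul.
Proof. by move=> f; apply: aut_eq => x /=; exact: aut_invK. Qed.

HB.instance Definition _ :=
  isGroup.Build aut aut_mulA aut_mul1 aut_mul1r aut_mulV aut_mulVr.

End Automorphisms.

(* An action of G on H is a [phi : {multiplicative G -> aut H}]: a
   multiplicative map between groups is a group homomorphism. *)

(* A record rather than a bare product, so that it does not pick up the
   componentwise group law of [H * G]. *)
Record sdprod (G H : groupType) (phi : {multiplicative G -> aut H}) :=
  SDPair { sd1 : H; sd2 : G }.

Section SemidirectProduct.
Variables (G H : groupType) (phi : {multiplicative G -> aut H}).

Let sd_pair (u : sdprod phi) := (sd1 u, sd2 u).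
Let pair_sd (p : H * G) := SDPair phi p.1 p.2.
Fact sd_pairK : cancel sd_pair pair_sd. Proof. by case. Qed.

HB.instance Definition _ := Choice.copy (sdprod phi) (can_type sd_pairK).

Definition sd_one : sdprod phi := SDPair phi 1 1.
Definition sd_mul (u v : sdprod phi) : sdprod phi :=
  SDPair phi (sd1 u * phi (sd2 u) (sd1 v)) (sd2 u * sd2 v).
Definition sd_inv (u : sdprod phi) : sdprod phi :=
  SDPair phi (phi (sd2 u)^-1 (sd1 u)^-1) (sd2 u)^-1.

Lemma act1 : phi 1 = 1.
Proof. by apply: (@mulgI _ (phi 1)); rewrite -gmulfM !mulg1. Qed.
Lemma aut1 (f : aut H) : f 1 = 1.
Proof. by apply: (@mulgI _ (f 1)); rewrite -aut_morph !mulg1. Qed.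
Lemma actM g g' h : phi (g * g') h = phi g (phi g' h).
Proof. by rewrite gmulfM. Qed.

Fact sd_mulA : associative sd_mul.
Proof.
by move=> [a x] [b y] [c z]; rewrite /sd_mul /= !mulgA actM aut_morph mulgA.
Qed.
Fact sd_mul1 : left_id sd_one sd_mul.
Proof. by move=> [a x]; rewrite /sd_mul /= act1 !mul1g. Qed.
Fact sd_mul1r : right_id sd_one sd_mul.
Proof. by move=> [a x]; rewrite /sd_mul /= aut1 !mulg1. Qed.
Fact sd_mulV : left_inverse sd_one sd_inv sd_mul.
Proof. by move=> [a x]; rewrite /sd_mul /= -aut_morph !mulVg aut1. Qed.
Fact sd_mulVr : right_inverse sd_one sd_inv sd_mul.
Proof. by move=> [a x]; rewrite /sd_mul /= -actM !mulgV act1 /= mulgV. Qed.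

HB.instance Definition _ :=
  isGroup.Build (sdprod phi) sd_mulA sd_mul1 sd_mul1r sd_mulV sd_mulVr.

Definition sd_inH (h : H) : sdprod phi := SDPair phi h 1.
Definition sd_inG (g : G) : sdprod phi := SDPair phi 1 g.

Definition Hhat : subgroup H :=
  gen [set z | exists (g : G) (h : H), z = phi g h * h^-1].

Definition Lsub : subgroup H := gen (Gamma2 H `|` Hhat).

(* [psi] is the action of K on M obtained by restricting [phi]. *)
Definition induced_action (K : subgroup G) (M : subgroup H)
    (psi : {multiplicative sg_group K -> aut (sg_group M)}) : Prop :=
  forall (k : sg_group K) (m : sg_group M), val (psi k m) = phi (val k) (val m).

End SemidirectProduct.

(* The inclusion identifying the semidirect product of subgroups M and K with
   a subset of that of H and G; when [psi] is induced by [phi] it is an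
   injective homomorphism (the two lemmas below), so its range is a subgroup. *)
Definition sd_incl (G H : groupType) (phi : {multiplicative G -> aut H})
    (K : subgroup G) (M : subgroup H)
    (psi : {multiplicative sg_group K -> aut (sg_group M)})
    (u : sdprod psi) : sdprod phi :=
  SDPair phi (val (sd1 u)) (val (sd2 u)).

Lemma sd_incl_morph (G H : groupType) (phi : {multiplicative G -> aut H})
    (K : subgroup G) (M : subgroup H)
    (psi : {multiplicative sg_group K -> aut (sg_group M)}) :
  induced_action phi psi -> {morph @sd_incl G H phi K M psi : u v / u * v}.
Proof.
by move=> ind u v; congr SDPair; congr (_ * _); exact: ind.
Qed.

Lemma sd_incl_inj (G H : groupType) (phi : {multiplicative G -> aut H})
    (K : subgroup G) (M : subgroup H)
    (psi : {multiplicative sg_group K -> aut (sg_group M)}) :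
  injective (@sd_incl G H phi K M psi).
Proof. by move=> [a x] [b y] [/val_inj -> /val_inj ->]. Qed.

(* Main.v *)
(* L contains every phi(g)(l) l^-1, hence is stable under the whole of G, and it
   contains Gamma2(H), hence is normal in H.  Modulo L the group H is abelian
   with trivial G-action, so the H-component of a commutator of H x| G lies in
   L.  Conversely phi(g)(h) h^-1 is the commutator of g^-1 and h^-1 in H x| G. *)
Require Import Defs.
From HB Require Import structures.
From mathcomp Require Import all_boot.
From mathcomp Require Import boolp classical_sets.

Local Open Scope classical_set_scope.
Local Open Scope group_scope.

(* Allows membership of [x] in a subgroup [K] to be written [K x]. *)
#[local] Identity Coercion fun_of_set : set >-> Funclass.

Section Subgroups.
Context {G : groupType}.
Implicit Types (K : subgroup G) (S : set G) (x y : G).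

Lemma subgroup_eq K K' : K = K' :> set G -> K = K'.
Proof.
case: K K' => [A cA] [B cB] /= AB; case: _ / AB in cB *.
by congr Subgroup; exact: Prop_irrelevance.
Qed.

Lemma group_closedP S :
  S 1 -> (forall x y, S x -> S y -> S (x / y)) -> group_closed (mem S).
Proof.
by move=> S1 SF; split=> [|x y /set_mem Sx /set_mem Sy]; apply/mem_set; [|exact: SF].
Qed.

Lemma subgroup1 K : K 1.
Proof. by apply/set_mem; case: (sg_closed K). Qed.

Lemma subgroupF K x y : K x -> K y -> K (x / y).
Proof.
by move=> Kx Ky; apply/set_mem; case: (sg_closed K) => _; apply; exact/mem_set.
Qed.

Lemma subgroupV K x : K x -> K x^-1.
Proof. by move=> Kx; rewrite -div1g; apply: subgroupF => //; exact: subgroup1. Qed.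

Lemma subgroupM K x y : K x -> K y -> K (x * y).
Proof.
by move=> Kx Ky; rewrite -(invgK y); apply: subgroupF => //; exact: subgroupV.
Qed.

Lemma sub_gen S : S `<=` gen S.
Proof. exact: sub_gen_smallest. Qed.

Lemma gen_sub S K : S `<=` K -> gen S `<=` K.
Proof. by move=> SK; apply: smallest_sub => //; exact: sg_closed. Qed.

Lemma Gamma2_commg x y : Gamma2 G [~ x, y].
Proof. by apply: sub_gen; exists x, y. Qed.

Lemma Gamma2_sub K : (forall x y, K [~ x, y]) -> Gamma2 G `<=` K.
Proof. by move=> KR; apply: gen_sub => _ [x [y ->]]. Qed.

(** Since [x ^ y = x * [~ x, y]], a subgroup that contains [Gamma2 G] is normal. *)
Lemma conjg_of_Gamma2_sub K x y : Gamma2 G `<=` K -> K x -> K (x ^ y).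
Proof.
move=> GK Kx; rewrite -(mulVKg x (x ^ y)) -commgEl.
by apply: subgroupM => //; apply: GK; exact: Gamma2_commg.
Qed.

End Subgroups.

Section Preimage.
Context {G H : groupType} (f : UMagmaMorphism.type G H).

Lemma preimage_closed (K : subgroup H) : group_closed (mem (f @^-1` K)).
Proof.
apply: group_closedP => [|x y Kx Ky]; rewrite /preimage /=.
  by rewrite gmulf1; exact: subgroup1.
by rewrite gmulfF; exact: subgroupF.
Qed.

(** The preimage of [K] is itself a subgroup, so it is enough to test generators, even when [K] lies
    in another group. *)
Lemma gen_preimage (S : set G) (K : subgroup H) :
  S `<=` f @^-1` K -> gen S `<=` f @^-1` K.
Proof. exact: (@gen_sub _ _ (Subgroup (preimage_closed K))). Qed.

Lemma Gamma2_preimage : Gamma2 G `<=` f @^-1` Gamma2 H.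
Proof.
by apply: gen_preimage => _ [x [y ->]]; rewrite /preimage /= gmulfR; exact: Gamma2_commg.
Qed.

End Preimage.

Section RestrictedAction.
Context {G H : groupType} (phi : {multiplicative G -> aut H}).
Context {K : subgroup G} {M : subgroup H}.
Hypothesis stableM : forall g h, M h -> M (phi g h).

(** Taking [g] in all of [G] gives the inverse map directly as the one for [g^-1], with no
    membership proof in [K] to carry. *)
Definition act_res_fun (g : G) (m : sg_group M) : sg_group M :=
  Sub (phi g (val m)) (mem_set (stableM g _ (set_mem (valP m)))).

Lemma act_res_morph g : {morph act_res_fun g : x y / x * y}.
Proof. by move=> x y; apply: val_inj; exact: aut_morph. Qed.

Lemma act_res_funK g : cancel (act_res_fun g) (act_res_fun g^-1).
Proof. by move=> x; apply: val_inj; rewrite /= -actM mulVg act1. Qed.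

Lemma act_res_funVK g : cancel (act_res_fun g^-1) (act_res_fun g).
Proof. by move=> x; apply: val_inj; rewrite /= -actM mulgV act1. Qed.

Definition act_res (k : sg_group K) : aut (sg_group M) :=
  Aut (act_res_morph (val k)) (act_res_funK (val k)) (act_res_funVK (val k)).

Lemma act_resM : {morph act_res : k k' / k * k'}.
Proof. by move=> k k'; apply: aut_eq => m; apply: val_inj; exact: actM. Qed.

HB.instance Definition _ :=
  isMultiplicative.Build (sg_group K) (aut (sg_group M)) act_res act_resM.

Lemma induced_action_exists :
  exists psi : {multiplicative sg_group K -> aut (sg_group M)},
    induced_action phi psi.
Proof. by exists act_res. Qed.

End RestrictedAction.

Section Embeddings.
Context {G H : groupType} (phi : {multiplicative G -> aut H}).

Lemma sd_inH_morph : monoid_morphism (sd_inH phi).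
Proof. by split=> // x y; congr SDPair; rewrite /= ?act1 ?mulg1. Qed.

Lemma sd_inG_morph : monoid_morphism (sd_inG phi).
Proof. by split=> // x y; congr SDPair; rewrite /= aut1 mulg1. Qed.

HB.instance Definition _ :=
  isUMagmaMorphism.Build H (sdprod phi) (sd_inH phi) sd_inH_morph.
HB.instance Definition _ :=
  isUMagmaMorphism.Build G (sdprod phi) (sd_inG phi) sd_inG_morph.

Lemma sd_decomp u : u = sd_inH phi (sd1 u) * sd_inG phi (sd2 u).
Proof. by case: u => h g; congr SDPair; rewrite /= ?act1 ?mulg1 ?mul1g. Qed.

(** Inside the semidirect product the action becomes conjugation. *)
Lemma sd_actE g h :
  sd_inH phi (phi g h) = sd_inG phi g * sd_inH phi h * sd_inG phi g^-1.
Proof. by congr SDPair; rewrite /= ?aut1 ?mul1g ?mulg1 ?mulgV. Qed.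

(** The inverses come from the convention [[~ x, y] = x^-1 * y^-1 * x * y]. *)
Lemma sd_inH_actV g h :
  sd_inH phi (phi g h * h^-1) = [~ sd_inG phi g^-1, sd_inH phi h^-1].
Proof. by rewrite gmulfM /= sd_actE !gmulfV /= commgEl conjgE !invgK !mulgA. Qed.

(** The range is the same for every [psi], which turns the claim about [Gamma2 (sdprod phi)] into an
    equality of sets of pairs. *)
Lemma range_sd_incl (K : subgroup G) (M : subgroup H)
    (psi : {multiplicative sg_group K -> aut (sg_group M)}) :
  range (@sd_incl G H phi K M psi) = [set u | M (sd1 u) /\ K (sd2 u)].
Proof.
apply/seteqP; split=> [_ [[m k] _ <-]|[h g] /= [Mh Kg]].
  by split; apply/set_mem; exact: valP.
by exists (SDPair psi (Sub h (mem_set Mh)) (Sub g (mem_set Kg))).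
Qed.

End Embeddings.

Section GammaTwo.
Context {G H : groupType} (phi : {multiplicative G -> aut H}).
Local Notation L := (Lsub phi).

Lemma Gamma2_sub_Lsub : Gamma2 H `<=` L.
Proof. by move=> h Gh; apply: sub_gen; left. Qed.

Lemma Lsub_actV g h : L (phi g h * h^-1).
Proof. by apply: sub_gen; right; apply: sub_gen; exists g, h. Qed.

Lemma Lsub_stable g h : L h -> L (phi g h).
Proof.
by move=> Lh; rewrite -(mulgVK h (phi g h)); apply: subgroupM => //; exact: Lsub_actV.
Qed.

Lemma Lsub_sd1_commg (u v : sdprod phi) : L (sd1 [~ u, v]).
Proof.
(* For [u = (a, x)] and [v = (b, y)], this compares the [H]-components of [v * u] and [u * v]. *)
have Lcomm a x b y : L ((b * phi y a)^-1 * (a * phi x b)).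
  rewrite -(mulgVK a (phi y a)) -(mulgVK b (phi x b)).
  (* With [phi y a = p * a] and [phi x b = q * b], the quotient is [[~ a, b]] up to conjugates of
     [p^-1] and [q], which are in [L]. *)
  set p := phi y a * a^-1; set q := phi x b * b^-1.
  have -> : (b * (p * a))^-1 * (a * (q * b)) = p^-1 ^ a * [~ a, b] * q ^ b.
    by rewrite commgEl !conjgE !invgM !mulgA !mulgK.
  apply: subgroupM; first apply: subgroupM.
  - apply: conjg_of_Gamma2_sub; first exact: Gamma2_sub_Lsub.
    by apply: subgroupV; exact: Lsub_actV.
  - by apply: Gamma2_sub_Lsub; exact: Gamma2_commg.
  - by apply: conjg_of_Gamma2_sub; [exact: Gamma2_sub_Lsub | exact: Lsub_actV].
set c := sd1 _.
(* This is the [H]-component of [u * v = v * u * [~ u, v]], solved for the image of [c] under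
   [sd2 v * sd2 u]. *)
have /(canRL (mulKg _)) cE : sd1 v * phi (sd2 v) (sd1 u) * phi (sd2 v * sd2 u) c
    = sd1 u * phi (sd2 u) (sd1 v).
  exact: esym (congr1 (@sd1 _ _ _) (commgC u v)).
(* Undoing that action recovers [c] and stays in [L] by stability. *)
rewrite -[c]/((1 : aut H) c) -(act1 phi) -(mulVg (sd2 v * sd2 u)) actM cE.
exact: Lsub_stable.
Qed.

Lemma sd_Lsub_closed :
  group_closed (mem [set u : sdprod phi | L (sd1 u) /\ Gamma2 G (sd2 u)]).
Proof.
apply: group_closedP => [|u v [Lu Gu] [Lv Gv]] /=.
  by split; [exact: (subgroup1 L) | exact: (subgroup1 (Gamma2 G))].
split; last exact: (subgroupF (Gamma2 G) _ _ Gu Gv).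
apply: (subgroupM L (sd1 u)) => //.
(* Two actions are stacked on [(sd1 v)^-1]: one from the product, one from the inverse of [v]. *)
do 2 apply: Lsub_stable; exact: subgroupV.
Qed.

(** Each pair factors as [(h, 1) * (1, g)]. Applied with [K] the commutator subgroup and with [K]
    the subgroup generated by the three images, this serves both claims of the theorem. *)
Lemma sd_Lsub_sub (K : subgroup (sdprod phi)) :
  sd_inH phi @` Gamma2 H `|` sd_inG phi @` Gamma2 G `|` sd_inH phi @` Hhat phi
    `<=` K ->
  [set u | L (sd1 u) /\ Gamma2 G (sd2 u)] `<=` K.
Proof.
move=> sK u [Lu Gu]; rewrite (sd_decomp phi u); apply: subgroupM.
  apply: (gen_preimage (sd_inH phi) _ K _ _ Lu) => h [Gh|Hh]; apply: sK.
    by left; left; exists h.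
  by right; exists h.
by apply: sK; left; right; exists (sd2 u).
Qed.

Lemma gens_sub_Gamma2 :
  sd_inH phi @` Gamma2 H `|` sd_inG phi @` Gamma2 G `|` sd_inH phi @` Hhat phi
    `<=` Gamma2 (sdprod phi).
Proof.
move=> _ [[[h Gh <-]|[g Gg <-]]|[h Hh <-]].
- exact: (Gamma2_preimage (sd_inH phi)).
- exact: (Gamma2_preimage (sd_inG phi)).
apply: (gen_preimage (sd_inH phi) _ (Gamma2 (sdprod phi)) _ _ Hh) => _ [g [k ->]].
by rewrite /preimage /= sd_inH_actV; exact: Gamma2_commg.
Qed.

Lemma Gamma2_sdprodE :
  Gamma2 (sdprod phi) = [set u | L (sd1 u) /\ Gamma2 G (sd2 u)] :> set _.
Proof.
apply/seteqP; split; last exact: sd_Lsub_sub gens_sub_Gamma2.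
apply: (Gamma2_sub (Subgroup sd_Lsub_closed)) => u v; split.
  exact: Lsub_sd1_commg.
(* The second projection is a homomorphism by computation, so it sends the commutator to
   [[~ sd2 u, sd2 v]]. *)
exact: (Gamma2_commg (sd2 u) (sd2 v)).
Qed.

End GammaTwo.

Theorem proposition29 (G H : groupType) (phi : {multiplicative G -> aut H}) :
  (exists psi : {multiplicative sg_group (Gamma2 G) -> aut (sg_group (Lsub phi))},
     induced_action phi psi /\
     range (@sd_incl G H phi (Gamma2 G) (Lsub phi) psi)
       = Gamma2 (sdprod phi) :> set (sdprod phi)) /\
  Gamma2 (sdprod phi)
    = gen (sd_inH phi @` Gamma2 H `|` sd_inG phi @` Gamma2 G
           `|` sd_inH phi @` Hhat phi).
Proof.
split.
  have [psi ind] := induced_action_exists phi (K := Gamma2 G) (Lsub_stable phi).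
  by exists psi; rewrite range_sd_incl Gamma2_sdprodE.
apply: subgroup_eq; apply/seteqP; split; last exact: gen_sub (gens_sub_Gamma2 phi).
by rewrite Gamma2_sdprodE; apply: sd_Lsub_sub; exact: sub_gen.
Qed.
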